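(* Let $K\subset\mathbb{R}^3$ be a triangular prism with vertices $V_1,\dots,V_6$, face centroids $M_1,\dots,M_5$ and affine functions $\lambda_0,\dots,\lambda_5$ as described in the context. Let $$\phi=\tfrac{5}{12}\lambda_0\lambda_4\lambda_5+\lambda_0(\lambda_1\lambda_2+\lambda_2\lambda_3+\lambda_3\lambda_1),\qquad P_K=P_2(K)\oplus\mathrm{span}\{\phi\},$$ and let $\Sigma_K=\{\sigma_i:\ i=1,\dots,11\}$, where for $v\in P_K$ $$\sigma_i(v)=v(V_i),\ i=1,\dots,6,\qquad \sigma_{i+6}(v)=v(M_i),\ i=1,\dots,5.$$ Then the finite element $(K,P_K,\Sigma_K)$ is well-defined, i.e. $\Sigma_K$ is unisolvent for $P_K$: for every $(\alpha_1,\dots,\alpha_{11})\in\mathbb{R}^{11}$ there exists exactly one $v\in P_K$ with $\sigma_i(v)=\alpha_i$ for all $i=1,\dots,11$.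
   Context: The prism $K$ is the product of a nondegenerate triangle in the $(x_1,x_2)$-variables and a nondegenerate interval in the $x_3$-variable. Its bottom face is $F_4=V_1V_2V_3$ and its top face is $F_5=V_4V_5V_6$, both parallel to the $x_1x_2$-plane, with the $x_3$-coordinate of $F_5$ greater than that of $F_4$, and $V_{i+3}$ lies directly above $V_i$ for $i=1,2,3$. The side faces, parallel to the $x_3$-axis, are the rectangles $F_1=V_2V_3V_6V_5$, $F_2=V_3V_1V_4V_6$, $F_3=V_1V_2V_5V_4$ (so $V_i,V_{i+3}\notin F_i$). $M_i$ is the centroid of $F_i$, $i=1,\dots,5$. For $i=1,\dots,5$, $\lambda_i$ is the affine function on $\mathbb{R}^3$ vanishing on the plane containing $F_i$, normalized by $\lambda_i(V_i)=1$ for $i=1,2,3$ and $\lambda_4(M_1)=-\lambda_5(M_1)=1$. $\lambda_0$ is the affine function vanishing on the plane through $M_1,M_2,M_3$ with $\lambda_0(V_4)=-\lambda_0(V_1)=1$. (Thus $\lambda_1,\lambda_2,\lambda_3$ are the barycentric coordinates of $(x_1,x_2)$ in the base triangle and do not depend on $x_3$, while $\lambda_0,\lambda_4,\lambda_5$ depend only on $x_3$.) $P_k(K)$ is the space of polynomials on $K$ of total degree at most $k$. *)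

(* Defs.v *)
From mathcomp Require Import all_boot all_order all_algebra.
From mathcomp Require Import reals.
From mathcomp Require Import mpoly.
From mathcomp Require Import ring lra.

Set Implicit Arguments.
Unset Strict Implicit.
Unset Printing Implicit Defensive.
Import Order.TTheory GRing.Theory Num.Theory.
Local Open Scope ring_scope.

Definition affine_hull (R : realType) (n : nat) (s : seq 'rV[R]_n)
    (x : 'rV[R]_n) : Prop :=
  exists c : 'I_(size s) -> R,
    \sum_i c i = 1 /\ x = \sum_i c i *: s`_i.

Definition conv_hull (R : realType) (n : nat) (s : seq 'rV[R]_n)
    (x : 'rV[R]_n) : Prop :=
  exists c : 'I_(size s) -> R,
    [/\ forall i, 0 <= c i, \sum_i c i = 1 & x = \sum_i c i *: s`_i].

(* Mean of the listed points: for the vertices of a segment, a triangle or a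
   parallelogram this is the centroid of the figure. *)
Definition centroid (R : realType) (n : nat) (s : seq 'rV[R]_n) : 'rV[R]_n :=
  (size s)%:R^-1 *: \sum_(p <- s) p.

Definition affine_fun (R : realType) (n : nat) (f : 'rV[R]_n -> R) : Prop :=
  exists (g : 'I_n -> R) (b : R), forall x, f x = \sum_i g i * x 0 i + b.

Definition vanishes_on (R : realType) (n : nat) (f : 'rV[R]_n -> R)
    (S : 'rV[R]_n -> Prop) : Prop :=
  forall x, S x -> f x = 0.

Definition point3 (R : realType) (p : 'rV[R]_2) (z : R) : 'rV[R]_3 :=
  row_mx p (const_mx z : 'rV[R]_1).

Definition pr12 (R : realType) (x : 'rV[R]_3) : 'rV[R]_2 :=
  lsubmx (x : 'rV[R]_(2 + 1)).

Definition pr3 (R : realType) (x : 'rV[R]_3) : R := x 0 ord_max.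

(* The data of a prism: the triangle A1 A2 A3, nondegenerate in the sense that
   its vertices are affinely independent, and the interval [zbot, ztop]. *)
Record prism (R : realType) := Prism {
  A1 : 'rV[R]_2;
  A2 : 'rV[R]_2;
  A3 : 'rV[R]_2;
  zbot : R;
  ztop : R;
  triangle_nondegenerate : free [:: A2 - A1; A3 - A1];
  interval_nondegenerate : zbot < ztop }.

Section Prism.
Variables (R : realType) (K : prism R).

Definition in_prism (x : 'rV[R]_3) : Prop :=
  conv_hull [:: A1 K; A2 K; A3 K] (pr12 x) /\ zbot K <= pr3 x <= ztop K.

Definition prism_pt : Type := {x : 'rV[R]_3 | in_prism x}.

Definition V1 := point3 (A1 K) (zbot K).
Definition V2 := point3 (A2 K) (zbot K).
Definition V3 := point3 (A3 K) (zbot K).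
Definition V4 := point3 (A1 K) (ztop K).
Definition V5 := point3 (A2 K) (ztop K).
Definition V6 := point3 (A3 K) (ztop K).

(* A face is represented by its list of vertices; the plane containing it is
   the affine hull of that list. *)
Definition F1 := [:: V2; V3; V6; V5].
Definition F2 := [:: V3; V1; V4; V6].
Definition F3 := [:: V1; V2; V5; V4].
Definition F4 := [:: V1; V2; V3].
Definition F5 := [:: V4; V5; V6].

Definition M1 := centroid F1.
Definition M2 := centroid F2.
Definition M3 := centroid F3.
Definition M4 := centroid F4.
Definition M5 := centroid F5.

Record prism_lambdas := PrismLambdas {
  lam0 : 'rV[R]_3 -> R;
  lam1 : 'rV[R]_3 -> R;
  lam2 : 'rV[R]_3 -> R;
  lam3 : 'rV[R]_3 -> R;
  lam4 : 'rV[R]_3 -> R;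
  lam5 : 'rV[R]_3 -> R;
  lam0_affine : affine_fun lam0;
  lam1_affine : affine_fun lam1;
  lam2_affine : affine_fun lam2;
  lam3_affine : affine_fun lam3;
  lam4_affine : affine_fun lam4;
  lam5_affine : affine_fun lam5;
  lam0_plane : vanishes_on lam0 (affine_hull [:: M1; M2; M3]);
  lam1_plane : vanishes_on lam1 (affine_hull F1);
  lam2_plane : vanishes_on lam2 (affine_hull F2);
  lam3_plane : vanishes_on lam3 (affine_hull F3);
  lam4_plane : vanishes_on lam4 (affine_hull F4);
  lam5_plane : vanishes_on lam5 (affine_hull F5);
  lam1_norm : lam1 V1 = 1;
  lam2_norm : lam2 V2 = 1;
  lam3_norm : lam3 V3 = 1;
  lam4_norm : lam4 M1 = 1;
  lam5_norm : - lam5 M1 = 1;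
  lam0_top : lam0 V4 = 1;
  lam0_bot : - lam0 V1 = 1 }.

Definition phi (L : prism_lambdas) (x : 'rV[R]_3) : R :=
  5 / 12 * lam0 L x * lam4 L x * lam5 L x
  + lam0 L x * (lam1 L x * lam2 L x + lam2 L x * lam3 L x
                + lam3 L x * lam1 L x).

(* [msize p] is the total degree plus one (and 0 for p = 0). *)
Definition poly_space (k : nat) (v : prism_pt -> R) : Prop :=
  exists p : {mpoly R[3]}, (msize p <= k.+1)%N /\
    forall x : prism_pt, v x = p.@[fun j => sval x 0 j].

(* P_2(K) + span {phi}; see phi_notin_P2 for the directness of the sum. *)
Definition P_K (L : prism_lambdas) (v : prism_pt -> R) : Prop :=
  exists (q : prism_pt -> R) (c : R), poly_space 2 q /\
    forall x : prism_pt, v x = q x + c * phi L (sval x).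

Definition nodes : seq 'rV[R]_3 :=
  [:: V1; V2; V3; V4; V5; V6; M1; M2; M3; M4; M5].

Lemma pr12_point3 (p : 'rV[R]_2) (z : R) : pr12 (point3 p z) = p.
Proof. exact: row_mxKl. Qed.

Lemma pr3_point3 (p : 'rV[R]_2) (z : R) : pr3 (point3 p z) = z.
Proof.
rewrite /pr3 /point3 mxE; case: splitP => [j /= e|j _]; last by rewrite mxE.
by have := ltn_ord j; rewrite -e.
Qed.

Lemma point3D (p p' : 'rV[R]_2) (z z' : R) :
  point3 p z + point3 p' z' = point3 (p + p') (z + z').
Proof.
apply: etrans (@add_row_mx _ 1 2 1 _ _ _ _) _;
  by apply: (congr1 (@row_mx R 1 2 1 _)); apply/matrixP => i j; rewrite !mxE.
Qed.

Lemma point3Z (a : R) (p : 'rV[R]_2) (z : R) : a *: point3 p z = point3 (a *: p) (a * z).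
Proof.
apply: etrans (@scale_row_mx _ 1 2 1 _ _ _) _;
  by apply: (congr1 (@row_mx R 1 2 1 _)); apply/matrixP => i j; rewrite !mxE.
Qed.

Lemma in_prism_point3 (a b c z : R) : 0 <= a -> 0 <= b -> 0 <= c -> a + b + c = 1 ->
  zbot K <= z <= ztop K ->
  in_prism (point3 (a *: A1 K + b *: A2 K + c *: A3 K) z).
Proof.
move=> a0 b0 c0 s1 hz; split; last by rewrite pr3_point3.
exists (fun i : 'I_3 => [:: a; b; c]`_i); split.
- by case=> [[|[|[|//]]] ?].
- by rewrite !big_ord_recl big_ord0 /= addr0 addrA.
- by rewrite pr12_point3 !big_ord_recl big_ord0 /= addr0 addrA.
Qed.

Lemma in_prism_eq x y : in_prism x -> x = y -> in_prism y.
Proof. by move=> ? <-. Qed.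

Lemma point3_eq (p p' : 'rV[R]_2) (z z' : R) : p = p' -> z = z' -> point3 p z = point3 p' z'.
Proof. by move=> -> ->. Qed.

Lemma M1E : M1 = point3 (2^-1 *: (A2 K + A3 K)) (2^-1 * (zbot K + ztop K)).
Proof.
rewrite /M1 /centroid !big_cons big_nil addr0 !point3D point3Z /=.
by apply: point3_eq; [apply/rowP => j; rewrite !mxE; field | field].
Qed.

Lemma M2E : M2 = point3 (2^-1 *: (A3 K + A1 K)) (2^-1 * (zbot K + ztop K)).
Proof.
rewrite /M2 /centroid !big_cons big_nil addr0 !point3D point3Z /=.
by apply: point3_eq; [apply/rowP => j; rewrite !mxE; field | field].
Qed.

Lemma M3E : M3 = point3 (2^-1 *: (A1 K + A2 K)) (2^-1 * (zbot K + ztop K)).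
Proof.
rewrite /M3 /centroid !big_cons big_nil addr0 !point3D point3Z /=.
by apply: point3_eq; [apply/rowP => j; rewrite !mxE; field | field].
Qed.

Lemma M4E : M4 = point3 (3^-1 *: (A1 K + A2 K + A3 K)) (zbot K).
Proof.
rewrite /M4 /centroid !big_cons big_nil addr0 !point3D point3Z /=.
by apply: point3_eq; [apply/rowP => j; rewrite !mxE; field | field].
Qed.

Lemma M5E : M5 = point3 (3^-1 *: (A1 K + A2 K + A3 K)) (ztop K).
Proof.
rewrite /M5 /centroid !big_cons big_nil addr0 !point3D point3Z /=.
by apply: point3_eq; [apply/rowP => j; rewrite !mxE; field | field].
Qed.

Lemma node_in_prism (i : 'I_11) : in_prism nodes`_i.
Proof.
have hz := interval_nondegenerate K.
have [hb ht hm] : [/\ zbot K <= zbot K <= ztop K, zbot K <= ztop K <= ztop K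
   & zbot K <= 2^-1 * (zbot K + ztop K) <= ztop K].
  by split; apply/andP; split; lra.
have a0 : (0 : R) <= 0 by [].
have a1 : (0 : R) <= 1 by [].
have a2 : (0 : R) <= 2^-1 by rewrite invr_ge0.
have a3 : (0 : R) <= 3^-1 by rewrite invr_ge0.
have s1 : (1 + 0 + 0 : R) = 1 by ring.
have s2 : (0 + 1 + 0 : R) = 1 by ring.
have s3 : (0 + 0 + 1 : R) = 1 by ring.
have m1 : (0 + 2^-1 + 2^-1 : R) = 1 by field.
have m2 : (2^-1 + 0 + 2^-1 : R) = 1 by field.
have m3 : (2^-1 + 2^-1 + 0 : R) = 1 by field.
have m4 : (3^-1 + 3^-1 + 3^-1 : R) = 1 by field.
case: i => [[|[|[|[|[|[|[|[|[|[|[|//]]]]]]]]]]] ?] /=;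
  rewrite ?M1E ?M2E ?M3E ?M4E ?M5E.
- by apply: (in_prism_eq (in_prism_point3 a1 a0 a0 s1 hb));
    apply: point3_eq => //; apply/rowP => j; rewrite !mxE; ring.
- by apply: (in_prism_eq (in_prism_point3 a0 a1 a0 s2 hb));
    apply: point3_eq => //; apply/rowP => j; rewrite !mxE; ring.
- by apply: (in_prism_eq (in_prism_point3 a0 a0 a1 s3 hb));
    apply: point3_eq => //; apply/rowP => j; rewrite !mxE; ring.
- by apply: (in_prism_eq (in_prism_point3 a1 a0 a0 s1 ht));
    apply: point3_eq => //; apply/rowP => j; rewrite !mxE; ring.
- by apply: (in_prism_eq (in_prism_point3 a0 a1 a0 s2 ht));
    apply: point3_eq => //; apply/rowP => j; rewrite !mxE; ring.
- by apply: (in_prism_eq (in_prism_point3 a0 a0 a1 s3 ht));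
    apply: point3_eq => //; apply/rowP => j; rewrite !mxE; ring.
- by apply: (in_prism_eq (in_prism_point3 a0 a2 a2 m1 hm));
    apply: point3_eq => //; apply/rowP => j; rewrite !mxE; ring.
- by apply: (in_prism_eq (in_prism_point3 a2 a0 a2 m2 hm));
    apply: point3_eq => //; apply/rowP => j; rewrite !mxE; ring.
- by apply: (in_prism_eq (in_prism_point3 a2 a2 a0 m3 hm));
    apply: point3_eq => //; apply/rowP => j; rewrite !mxE; ring.
- by apply: (in_prism_eq (in_prism_point3 a3 a3 a3 m4 hb));
    apply: point3_eq => //; apply/rowP => j; rewrite !mxE; ring.
- by apply: (in_prism_eq (in_prism_point3 a3 a3 a3 m4 ht));
    apply: point3_eq => //; apply/rowP => j; rewrite !mxE; ring.
Qed.

(* The index i : 'I_11 stands for sigma_(i+1). *)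
Definition sigma (i : 'I_11) (v : prism_pt -> R) : R :=
  v (exist in_prism nodes`_i (node_in_prism i)).

Lemma hull_mem n (s : seq 'rV[R]_n) (i : 'I_(size s)) : affine_hull s s`_i.
Proof.
exists (fun j => (j == i)%:R); split.
  by rewrite (bigD1 i) //= eqxx big1 ?addr0 // => j /negbTE ->.
rewrite (bigD1 i) //= eqxx scale1r big1 ?addr0 // => j /negbTE ->.
by rewrite scale0r.
Qed.

Lemma affine_point3 (f : 'rV[R]_3 -> R) : affine_fun f ->
  exists g0 g1 g2 b, forall (p : 'rV[R]_2) z,
    f (point3 p z) = g0 * p 0 0 + g1 * p 0 1 + g2 * z + b.
Proof.
case=> g [b fE]; exists (g 0), (g 1), (g ord_max), b => p z.
have e2 := pr3_point3 p z; rewrite /pr3 in e2.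
have e01 (j : 'I_2) (k : 'I_3) : j = k :> nat -> point3 p z 0 k = p 0 j.
  move=> ejk; rewrite mxE; case: splitP => [j' /= e|j' /= e].
    by congr (p _ _); apply: val_inj; rewrite /= -e -ejk.
  by have := ltn_ord j; rewrite ejk e.
rewrite fE !big_ord_recl big_ord0 addr0.
rewrite (e01 0 ord0) // (e01 1 (lift ord0 ord0)) //.
have -> : lift ord0 (lift ord0 ord0) = ord_max :> 'I_3 by apply: val_inj.
have -> : lift ord0 ord0 = 1 :> 'I_3 by apply: val_inj.
by rewrite e2 !addrA.
Qed.

Lemma affine_of_coefs (g0 g1 g2 b : R) :
  exists2 f : 'rV[R]_3 -> R, affine_fun f & forall (p : 'rV[R]_2) z,
    f (point3 p z) = g0 * p 0 0 + g1 * p 0 1 + g2 * z + b.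
Proof.
pose f (x : 'rV[R]_3) := g0 * pr12 x 0 0 + g1 * pr12 x 0 1 + g2 * pr3 x + b.
exists f; last by move=> p z; rewrite /f pr12_point3 pr3_point3.
exists (fun i : 'I_3 => [:: g0; g1; g2]`_i), b => x.
rewrite !big_ord_recl big_ord0 addr0 /= !addrA /f /pr12 /pr3 !mxE.
by congr (_ * x _ _ + _ * x _ _ + _ * x _ _ + _); apply: val_inj.
Qed.

Lemma vanishes_on_hull n (f : 'rV[R]_n -> R) (s : seq 'rV[R]_n) :
  affine_fun f -> (forall i : 'I_(size s), f s`_i = 0) ->
  vanishes_on f (affine_hull s).
Proof.
case=> g [b fE] f0 x [c [c1 ->]].
rewrite fE -[b]mul1r -c1 mulr_suml.
under eq_bigr do rewrite summxE mulr_sumr.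
rewrite exchange_big -big_split big1 //= => i _.
transitivity (c i * f s`_i); last by rewrite f0 mulr0.
rewrite fE mulrDr mulr_sumr; congr (_ + _); apply: eq_bigr => j _.
by rewrite mxE; ring.
Qed.

Lemma triangle_det_neq0 :
  (A2 K - A1 K) 0 0 * (A3 K - A1 K) 0 1 - (A2 K - A1 K) 0 1 * (A3 K - A1 K) 0 0
    != 0.
Proof.
have := triangle_nondegenerate K.
move: (A2 K - A1 K) (A3 K - A1 K) => u w fr.
apply/eqP => d0.
have key (a b : R) : a *: u + b *: w = 0 -> a = 0 /\ b = 0.
  move=> ab0; have /freeP h := fr.
  have {}h := h (fun i : 'I_2 => [:: a; b]`_i).
  have h0 : \sum_(i < 2) [:: a; b]`_i *: [:: u; w]`_i = 0.
    by rewrite !big_ord_recl big_ord0 addr0.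
  by split; [exact: (h h0 ord0) | exact: (h h0 ord_max)].
have row0 (v : 'rV[R]_2) : v 0 0 = 0 -> v 0 1 = 0 -> v = 0.
  move=> v0 v1; apply/rowP => j; rewrite mxE.
  case: j => [[|[|//]] hj].
    by rewrite -[RHS]v0; congr (v _ _); apply: val_inj.
  by rewrite -[RHS]v1; congr (v _ _); apply: val_inj.
have [w1 u1] : w 0 1 = 0 /\ - u 0 1 = 0.
  by apply: key; apply: row0; rewrite !mxE; [rewrite -d0|]; ring.
have [w0 u0] : w 0 0 = 0 /\ - u 0 0 = 0.
  by apply: key; apply: row0; rewrite !mxE;
    [|rewrite -[RHS]oppr0 -d0]; ring.
have [e _] : (1 : R) = 0 /\ (0 : R) = 0.
  apply: key; rewrite scale0r addr0 scale1r; apply: row0.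
    by rewrite -[LHS]opprK u0 oppr0.
  by rewrite -[LHS]opprK u1 oppr0.
by have := oner_neq0 R; rewrite e eqxx.
Qed.

Lemma prism_lambdas_inhabited : inhabited prism_lambdas.
Proof.
have hz : ztop K - zbot K != 0.
  by rewrite subr_eq0 gt_eqF // interval_nondegenerate.
have hd := triangle_det_neq0; rewrite !mxE in hd.
pose h := (ztop K - zbot K)^-1.
pose d := ((A2 K 0 0 - A1 K 0 0) * (A3 K 0 1 - A1 K 0 1)
           - (A2 K 0 1 - A1 K 0 1) * (A3 K 0 0 - A1 K 0 0))^-1.
have bary (p q : 'rV[R]_2) : exists2 f : 'rV[R]_3 -> R, affine_fun f &
    forall x z, f (point3 x z) =
      ((q 0 0 - p 0 0) * (x 0 1 - p 0 1)
       - (q 0 1 - p 0 1) * (x 0 0 - p 0 0)) * d.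
  have [f fa fE] := affine_of_coefs (- (q 0 1 - p 0 1) * d)
    ((q 0 0 - p 0 0) * d) 0
    (((q 0 1 - p 0 1) * p 0 0 - (q 0 0 - p 0 0) * p 0 1) * d).
  by exists f => // x z; rewrite fE; ring.
have [f1 f1a f1E] := bary (A2 K) (A3 K).
have [f2 f2a f2E] := bary (A3 K) (A1 K).
have [f3 f3a f3E] := bary (A1 K) (A2 K).
have [f0 f0a f0E] := affine_of_coefs 0 0 (2 * h) (- (zbot K + ztop K) * h).
have [f4 f4a f4E] := affine_of_coefs 0 0 (2 * h) (- 2 * zbot K * h).
have [f5 f5a f5E] := affine_of_coefs 0 0 (2 * h) (- 2 * ztop K * h).
split; apply: (@PrismLambdas f0 f1 f2 f3 f4 f5) => //;
  try (apply: vanishes_on_hull => //;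
       case=> [[|[|[|[|//]]]] hi] //=);
  rewrite ?M1E ?M2E ?M3E ?f0E ?f1E ?f2E ?f3E ?f4E ?f5E ?mxE /h /d //;
  by field.
Qed.

Definition axis_pt (t : R) : 'rV[R]_3 :=
  point3 (3^-1 *: (A1 K + A2 K + A3 K)) ((1 - t) * zbot K + t * ztop K).

Lemma axis_in_prism t : 0 <= t <= 1 -> in_prism (axis_pt t).
Proof.
move=> /andP[t0 t1]; have hz := interval_nondegenerate K.
rewrite /axis_pt !scalerDr; apply: in_prism_point3; rewrite ?invr_ge0 //.
  by field.
by apply/andP; split; nra.
Qed.

Lemma affine_axis (f : 'rV[R]_3 -> R) (t : R) : affine_fun f ->
  [/\ f (axis_pt t) =
       (1 - t) * (f V1 + f V2 + f V3) / 3 + t * (f V4 + f V5 + f V6) / 3,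
      f V1 + f V5 = f V2 + f V4, f V1 + f V6 = f V3 + f V4,
      f M1 = (f V2 + f V3 + f V6 + f V5) / 4 &
      f M2 = (f V3 + f V1 + f V4 + f V6) / 4 /\
      f M3 = (f V1 + f V2 + f V5 + f V4) / 4].
Proof.
move=> /affine_point3[g0 [g1 [g2 [b fE]]]].
rewrite /axis_pt M1E M2E M3E /V1 /V2 /V3 /V4 /V5 /V6 !fE !mxE.
by split; [field|ring|ring|field|split; field].
Qed.

Lemma phi_axis (L : prism_lambdas) (t : R) :
  phi L (axis_pt t) = (2 * t - 1) * (5 / 3 * t * (t - 1) + 3^-1).
Proof.
have van (f : 'rV[R]_3 -> R) s (v : vanishes_on f (affine_hull s)) :
  forall i : 'I_(size s), f s`_i = 0 by move=> i; apply/v/hull_mem.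
have e1 : lam1 L (axis_pt t) = 3^-1.
  have [-> h1 h2 _ _] := affine_axis t (lam1_affine L).
  have := van _ _ (@lam1_plane L); move: (lam1_norm L) => n v.
  have := (v (@Ordinal 4 0 isT), v (@Ordinal 4 1 isT),
    v (@Ordinal 4 2 isT), v (@Ordinal 4 3 isT)) => /= -[[[v0 v1] v2] v3].
  have -> : lam1 L V4 = 1 by move: h1; rewrite v0 v3 n; lra.
  by rewrite v0 v1 v2 v3 n; field.
have e2 : lam2 L (axis_pt t) = 3^-1.
  have [-> h1 h2 _ _] := affine_axis t (lam2_affine L).
  have := van _ _ (@lam2_plane L); move: (lam2_norm L) => n v.
  have := (v (@Ordinal 4 0 isT), v (@Ordinal 4 1 isT),
    v (@Ordinal 4 2 isT), v (@Ordinal 4 3 isT)) => /= -[[[v0 v1] v2] v3].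
  have -> : lam2 L V5 = 1 by move: h1; rewrite v1 v2 n; lra.
  by rewrite v0 v1 v2 v3 n; field.
have e3 : lam3 L (axis_pt t) = 3^-1.
  have [-> h1 h2 _ _] := affine_axis t (lam3_affine L).
  have := van _ _ (@lam3_plane L); move: (lam3_norm L) => n v.
  have := (v (@Ordinal 4 0 isT), v (@Ordinal 4 1 isT),
    v (@Ordinal 4 2 isT), v (@Ordinal 4 3 isT)) => /= -[[[v0 v1] v2] v3].
  have -> : lam3 L V6 = 1 by move: h2; rewrite v0 v3 n; lra.
  by rewrite v0 v1 v2 v3 n; field.
have e0 : lam0 L (axis_pt t) = 2 * t - 1.
  have [-> h1 h2 m1 [m2 m3]] := affine_axis t (lam0_affine L).
  have := van _ _ (@lam0_plane L).
  move: (lam0_top L) (lam0_bot L) => nt nb v.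
  have := (v (@Ordinal 3 0 isT), v (@Ordinal 3 1 isT),
    v (@Ordinal 3 2 isT)) => /= -[[v0 v1] v2].
  rewrite nt in h1 h2 m1 m2 m3 *.
  have nb' : lam0 L V1 = -1 by lra.
  rewrite nb' in h1 h2 m1 m2 m3 *.
  have [-> -> -> ->] : [/\ lam0 L V2 = -1, lam0 L V3 = -1,
    lam0 L V5 = 1 & lam0 L V6 = 1] by split; lra.
  by field.
have e4 : lam4 L (axis_pt t) = 2 * t.
  have [-> h1 h2 m1 _] := affine_axis t (lam4_affine L).
  have := van _ _ (@lam4_plane L); move: (lam4_norm L) => n v.
  have := (v (@Ordinal 3 0 isT), v (@Ordinal 3 1 isT),
    v (@Ordinal 3 2 isT)) => /= -[[v0 v1] v2].
  have [-> -> ->] : [/\ lam4 L V4 = 2, lam4 L V5 = 2 & lam4 L V6 = 2].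
    by split; lra.
  by rewrite v0 v1 v2; field.
have e5 : lam5 L (axis_pt t) = 2 * (t - 1).
  have [-> h1 h2 m1 _] := affine_axis t (lam5_affine L).
  have := van _ _ (@lam5_plane L); move: (lam5_norm L) => n v.
  have := (v (@Ordinal 3 0 isT), v (@Ordinal 3 1 isT),
    v (@Ordinal 3 2 isT)) => /= -[[v0 v1] v2].
  have [-> -> ->] : [/\ lam5 L V1 = -2, lam5 L V2 = -2 & lam5 L V3 = -2].
    by split; lra.
  by rewrite v0 v1 v2; field.
by rewrite /phi e0 e1 e2 e3 e4 e5; field.
Qed.

Lemma quadratic_third_difference (p : {mpoly R[3]}) (u0 u1 z h : R) :
  (msize p <= 3)%N ->
  let ev x := p.@[fun j : 'I_3 => [:: u0; u1; x]`_j] in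
  ev (z + 3 * h) - 3 * ev (z + 2 * h) + 3 * ev (z + h) - ev z = 0.
Proof.
move=> sp ev; rewrite /ev !mevalE !mulr_sumr -!sumrN -!big_split.
rewrite big_seq big1 //= => m /msize_mdeg_lt mp.
have : (mdeg m <= 2)%N by apply: leq_trans mp sp.
rewrite mdegE !big_ord_recl !big_ord0 /= !mulr1.
move: (m _) (m _) (m _) => c b a abc.
have : (c <= 2)%N.
  by apply: leq_trans abc; rewrite addn0 addnA leq_addl.
by case: c {abc} => [|[|[|//]]] _; rewrite ?expr0 ?expr1 ?expr2; ring.
Qed.

Lemma phi_notin_P2 (L : prism_lambdas) (c : R) :
  poly_space 2 (fun x : prism_pt => c * phi L (sval x)) -> c = 0.
Proof.
case=> p [sp pE].
pose g : 'rV[R]_2 := 3^-1 *: (A1 K + A2 K + A3 K).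
pose d := 3^-1 * (ztop K - zbot K).
have evE (t : R) : 0 <= t <= 1 ->
    p.@[fun j : 'I_3 => [:: g 0 0; g 0 1; zbot K + 3 * t * d]`_j]
    = c * ((2 * t - 1) * (5 / 3 * t * (t - 1) + 3^-1)).
  move=> ht; rewrite -(phi_axis L).
  rewrite (pE (exist _ _ (axis_in_prism ht))) /=.
  apply: meval_eq => j; rewrite /axis_pt -/g.
  have -> : (1 - t) * zbot K + t * ztop K = zbot K + 3 * t * d.
    by rewrite /d; field.
  rewrite [RHS]mxE; case: splitP => k jk; rewrite jk.
    case: k jk => [[|[|//]] hk] _ /=; congr (g _ _); exact: val_inj.
  by case: k jk => [[|//] hk] _ /=; rewrite [RHS]mxE.
have := @quadratic_third_difference p (g 0 0) (g 0 1) (zbot K) d sp.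
have i0 : 0 <= (0 : R) <= 1 by lra.
have i1 : 0 <= (3^-1 : R) <= 1 by lra.
have i2 : 0 <= (2 / 3 : R) <= 1 by lra.
have i3 : 0 <= (1 : R) <= 1 by lra.
move: (evE _ i0) (evE _ i1) (evE _ i2) (evE _ i3).
have -> : zbot K + 3 * 0 * d = zbot K by ring.
have -> : zbot K + 3 * 3^-1 * d = zbot K + d by field.
have -> : zbot K + 3 * (2 / 3) * d = zbot K + 2 * d by field.
have -> : zbot K + 3 * 1 * d = zbot K + 3 * d by ring.
by move=> h0 h1 h2 h3; cbv zeta beta; rewrite h0 h1 h2 h3 => h; lra.
Qed.

End Prism.

(* Main.v *)
(** In the coordinates [l1, l2, l3] (barycentric) and [s = lambda0], one has
    [lambda4 = s + 1] and [lambda5 = s - 1], and the nodal basis can be written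
    down explicitly.  The 11 values of [v] at the nodes determine [v] because
    interpolation in this basis reproduces [phi] and every product of two affine
    functions, and those products span [P_2]. *)
Require Import Defs.
From mathcomp Require Import all_boot all_order all_algebra.
From mathcomp Require Import reals.
From mathcomp Require Import boolp mpoly ring lra.

Set Implicit Arguments.
Unset Strict Implicit.
Unset Printing Implicit Defensive.
Local Open Scope ring_scope.
Import Order.TTheory GRing.Theory Num.Theory.

(** * Affine functions as polynomials, and monomials of degree at most two as their products *)

Section AffineFunctions.
Variables (R : realType) (n : nat).

Lemma affine_cst (a : R) : affine_fun (fun _ : 'rV[R]_n => a).
Proof. by exists (fun=> 0), a => x; rewrite big1 ?add0r // => i _; rewrite mul0r. Qed.

Lemma affine_coord (i : 'I_n) : affine_fun (fun x : 'rV[R]_n => x 0 i).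
Proof.
exists (fun j => (j == i)%:R), 0 => x.
rewrite addr0 (bigD1 i) //= eqxx mul1r big1 ?addr0 // => j /negbTE ->.
by rewrite mul0r.
Qed.

Lemma affine_mpoly (f : 'rV[R]_n -> R) : affine_fun f ->
  exists2 p : {mpoly R[n]}, (msize p <= 2)%N & forall x : 'rV[R]_n, f x = p.@[fun j => x 0 j].
Proof.
case=> g [b fE]; exists (\sum_i g i *: 'X_i + b%:MP); last first.
  move=> x; rewrite fE mevalD mevalC raddf_sum /=; congr (_ + _).
  by apply: eq_bigr => i _; rewrite mevalZ mevalXU.
apply: leq_trans (msizeD_le _ _) _; rewrite geq_max; apply/andP; split.
  apply: leq_trans (msize_sum _ _ _) _; apply/bigmax_leqP => i _.
  by apply: leq_trans (msizeZ_le _ _) _; rewrite msizeX mdeg1.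
by rewrite msizeC; case: (b != 0).
Qed.

(** Reduces statements linear in a polynomial of $P_2$ to products of two affine functions: one
    variable is split off a monomial of degree two, and the constant 1 serves as second factor in
    lower degree. *)
Lemma monomial_affine_mul (m : 'X_{1..n}) : (mdeg m <= 2)%N ->
  exists f g : 'rV[R]_n -> R, [/\ affine_fun f, affine_fun g &
    forall x : 'rV[R]_n, 'X_[R, m].@[fun j => x 0 j] = f x * g x].
Proof.
have deg1 (k : 'X_{1..n}) : (mdeg k <= 1)%N ->
    exists2 f : 'rV[R]_n -> R, affine_fun f &
      forall x : 'rV[R]_n, 'X_[R, k].@[fun j => x 0 j] = f x.
  rewrite leq_eqVlt ltnS leqn0 => /orP[/mdeg1P[i /eqP ->]|].
    by exists (fun x => x 0 i); [exact: affine_coord | move=> x; rewrite mevalXU].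
  rewrite mdeg_eq0 => /eqP ->; exists (fun=> 1); first exact: affine_cst.
  by move=> x; rewrite mpolyX0 meval1.
rewrite leq_eqVlt ltnS => /orP[/eqP m2|/deg1[f fa fE]]; last first.
  by exists f, (fun=> 1); split=> // [|x]; [exact: affine_cst | rewrite fE mulr1].
have [i mi] : exists i, m i != 0%N.
  apply/existsP; apply: contraPT m2 => /existsPn m0.
  by rewrite mdegE big1 // => i _; apply/eqP; rewrite -[_ == _]negbK.
have Um : (U_(i) <= m)%MM by rewrite lep1mP.
have /deg1[f fa fE] : (mdeg (m - U_(i))%MM <= 1)%N.
  by rewrite -ltnS -m2 -{2}(submK Um) mdegD mdeg1 addn1.
exists (fun x => x 0 i), f; split=> // [|x]; first exact: affine_coord.
by rewrite -(submK Um) addmC mpolyXD mevalM mevalXU fE.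
Qed.

End AffineFunctions.

(** * Closure properties of the polynomial spaces on the prism *)

Section PolySpace.
Variables (R : realType) (K : prism R).

Lemma poly_space_add k (v w : prism_pt K -> R) :
  poly_space k v -> poly_space k w -> poly_space k (fun x => v x + w x).
Proof.
case=> p [sp pE] [q [sq qE]]; exists (p + q); split; last first.
  by move=> x; rewrite mevalD pE qE.
by apply: leq_trans (msizeD_le _ _) _; rewrite geq_max sp.
Qed.

Lemma poly_space_scale k a (v : prism_pt K -> R) :
  poly_space k v -> poly_space k (fun x => a * v x).
Proof.
case=> p [sp pE]; exists (a *: p); split; last by move=> x; rewrite mevalZ pE.
exact: leq_trans (msizeZ_le _ _) sp.
Qed.

Lemma poly_space_mul (f g : 'rV[R]_3 -> R) : affine_fun f -> affine_fun g ->
  poly_space 2 (fun x : prism_pt K => f (sval x) * g (sval x)).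
Proof.
move=> /affine_mpoly[p sp pE] /affine_mpoly[q sq qE].
exists (p * q); split; last by move=> x; rewrite mevalM -pE -qE.
(* [msizeM] needs nonzero factors; it then gives the sum of the two sizes minus one, here at most
   3. *)
have [->|p0] := eqVneq p 0; first by rewrite mul0r msize0.
have [->|q0] := eqVneq q 0; first by rewrite mulr0 msize0.
by rewrite msizeM // -ltnS prednK; [exact: (@leq_add _ _ 2 2) | rewrite addn_gt0 lt0n msize_poly_eq0 p0].
Qed.

End PolySpace.

(** * Barycentric coordinates in the base and a height [s] running from -1 to 1 *)

Section Prism.
Variables (R : realType) (K : prism R) (L : prism_lambdas K).

Definition prism_coord (l1 l2 l3 s : R) : 'rV[R]_3 :=
  point3 (l1 *: A1 K + l2 *: A2 K + l3 *: A3 K)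
    ((1 - s) / 2 * zbot K + (1 + s) / 2 * ztop K).

Lemma nodes_prism_coord : nodes K =
  [:: prism_coord 1 0 0 (-1); prism_coord 0 1 0 (-1); prism_coord 0 0 1 (-1);
      prism_coord 1 0 0 1; prism_coord 0 1 0 1; prism_coord 0 0 1 1;
      prism_coord 0 2^-1 2^-1 0; prism_coord 2^-1 0 2^-1 0;
      prism_coord 2^-1 2^-1 0 0;
      prism_coord 3^-1 3^-1 3^-1 (-1); prism_coord 3^-1 3^-1 3^-1 1].
Proof.
rewrite /nodes M1E M2E M3E M4E M5E /prism_coord.
by congr [:: _; _; _; _; _; _; _; _; _; _; _]; apply: point3_eq;
  do ?[by apply/rowP => j; rewrite !mxE; ring | by field].
Qed.

Lemma prism_coord_exists x : in_prism K x ->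
  exists l1 l2 l3 s, l1 + l2 + l3 = 1 /\ x = prism_coord l1 l2 l3 s.
Proof.
case=> -[c [_ c1 cx]] _; have hz := interval_nondegenerate K.
have dz : ztop K - zbot K != 0 by rewrite subr_eq0 gt_eqF.
(* The last witness solves [(1 - s) / 2 * zbot + (1 + s) / 2 * ztop = pr3 x] for [s]. *)
exists (c 0), (c 1), (c (lift ord0 (lift ord0 ord0))),
  ((2 * pr3 x - zbot K - ztop K) / (ztop K - zbot K)).
move: c1 cx; rewrite !big_ord_recl !big_ord0 /= !addr0 !addrA => c1 cx.
have e1 : lift ord0 ord0 = 1 :> 'I_3 by apply: val_inj.
rewrite e1 in c1 cx; split=> //.
have -> : x = point3 (pr12 x) (pr3 x).
  rewrite -[LHS](@hsubmxK _ 1 2 1); apply: (congr1 (@row_mx R 1 2 1 _)).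
  by apply/rowP => j; rewrite !mxE /pr3 [j]ord1; congr (x _ _); apply: val_inj.
rewrite /prism_coord pr3_point3; apply: point3_eq; last by field.
exact: cx.
Qed.

(** The point is the affine combination of the six vertices with weights [(1 - s) / 2 * li] at the
    bottom and [(1 + s) / 2 * li] at the top. *)
Lemma affine_prism_coord (f : 'rV[R]_3 -> R) (l1 l2 l3 s : R) :
  affine_fun f -> l1 + l2 + l3 = 1 ->
  f (prism_coord l1 l2 l3 s) =
    (1 - s) / 2 * (l1 * f (V1 K) + l2 * f (V2 K) + l3 * f (V3 K)) +
    (1 + s) / 2 * (l1 * f (V4 K) + l2 * f (V5 K) + l3 * f (V6 K)).
Proof.
move=> /affine_point3[g0 [g1 [g2 [b fE]]]] l1E.
have -> : l3 = 1 - l1 - l2 by rewrite -l1E; ring.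
by rewrite /prism_coord /V1 /V2 /V3 /V4 /V5 /V6 !fE !mxE; field.
Qed.

(** The parallelogram relations from [affine_axis] make the increment along the three vertical edges
    equal, so no cross term [s * li] survives; the constant term is absorbed because the [li] sum to
    1. *)
Lemma affine_split (f : 'rV[R]_3 -> R) : affine_fun f ->
  exists a1 a2 a3 b, forall l1 l2 l3 s, l1 + l2 + l3 = 1 ->
  f (prism_coord l1 l2 l3 s) = l1 * a1 + l2 * a2 + l3 * a3 + s * b.
Proof.
move=> fa; have [_ h1 h2 _ _] := affine_axis K 0 fa.
exists ((f (V1 K) + f (V4 K)) / 2), ((f (V2 K) + f (V5 K)) / 2),
  ((f (V3 K) + f (V6 K)) / 2), ((f (V4 K) - f (V1 K)) / 2) => l1 l2 l3 s l1E.
rewrite affine_prism_coord //.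
have -> : f (V5 K) = f (V2 K) + f (V4 K) - f (V1 K) by rewrite -h1; ring.
have -> : f (V6 K) = f (V3 K) + f (V4 K) - f (V1 K) by rewrite -h2; ring.
have -> : l3 = 1 - l1 - l2 by rewrite -l1E; ring.
by field.
Qed.

(** Vanishing, normalization and the relations of [affine_axis] form a linear system that fixes the
    vertex values of each function; [affine_prism_coord] then interpolates them. *)
Lemma lambda_prism_coord (l1 l2 l3 s : R) : l1 + l2 + l3 = 1 ->
  let x := prism_coord l1 l2 l3 s in
  [/\ lam0 L x = s, lam1 L x = l1, lam2 L x = l2, lam3 L x = l3 &
      lam4 L x = s + 1 /\ lam5 L x = s - 1].
Proof.
move=> l1E x.
have van (f : 'rV[R]_3 -> R) p (v : vanishes_on f (affine_hull p)) :
  forall i : 'I_(size p), f p`_i = 0 by move=> i; apply/v/hull_mem.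
have van3 (f : 'rV[R]_3 -> R) p q r (v : vanishes_on f (affine_hull [:: p; q; r])) :
  [/\ f p = 0, f q = 0 & f r = 0].
  have h := van _ _ v.
  by split; [exact: (h (@Ordinal 3 0 isT)) | exact: (h (@Ordinal 3 1 isT))
    | exact: (h (@Ordinal 3 2 isT))].
have van4 (f : 'rV[R]_3 -> R) p q r t (v : vanishes_on f (affine_hull [:: p; q; r; t])) :
  [/\ f p = 0, f q = 0, f r = 0 & f t = 0].
  have h := van _ _ v.
  by split; [exact: (h (@Ordinal 4 0 isT)) | exact: (h (@Ordinal 4 1 isT))
    | exact: (h (@Ordinal 4 2 isT)) | exact: (h (@Ordinal 4 3 isT))].
have l3E : l3 = 1 - l1 - l2 by rewrite -l1E; ring.
split; [| | | |split].
- have fa := lam0_affine L; rewrite affine_prism_coord //.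
  have [_ h1 h2 m1 [m2 m3]] := affine_axis K 0 fa.
  have [v1 v2 v3] := van3 _ _ _ _ (@lam0_plane _ _ L).
  move: (lam0_top L) (lam0_bot L) => nt nb.
  have [-> -> -> -> ->] : [/\ lam0 L (V1 K) = -1, lam0 L (V2 K) = -1, lam0 L (V3 K) = -1,
    lam0 L (V5 K) = 1 & lam0 L (V6 K) = 1] by split; lra.
  by rewrite nt l3E; field.
- have fa := lam1_affine L; rewrite affine_prism_coord //.
  have [_ h1 h2 _ _] := affine_axis K 0 fa.
  have [v1 v2 v3 v4] := van4 _ _ _ _ _ (@lam1_plane _ _ L); have n := lam1_norm L.
  have -> : lam1 L (V4 K) = 1 by lra.
  by rewrite v1 v2 v3 v4 n; field.
- have fa := lam2_affine L; rewrite affine_prism_coord //.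
  have [_ h1 h2 _ _] := affine_axis K 0 fa.
  have [v1 v2 v3 v4] := van4 _ _ _ _ _ (@lam2_plane _ _ L); have n := lam2_norm L.
  have -> : lam2 L (V5 K) = 1 by lra.
  by rewrite v1 v2 v3 v4 n; field.
- have fa := lam3_affine L; rewrite affine_prism_coord //.
  have [_ h1 h2 _ _] := affine_axis K 0 fa.
  have [v1 v2 v3 v4] := van4 _ _ _ _ _ (@lam3_plane _ _ L); have n := lam3_norm L.
  have -> : lam3 L (V6 K) = 1 by lra.
  by rewrite v1 v2 v3 v4 n; field.
- have fa := lam4_affine L; rewrite affine_prism_coord //.
  have [_ h1 h2 m1 _] := affine_axis K 0 fa.
  have [v1 v2 v3] := van3 _ _ _ _ (@lam4_plane _ _ L); have n := lam4_norm L.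
  have [-> -> ->] : [/\ lam4 L (V4 K) = 2, lam4 L (V5 K) = 2 & lam4 L (V6 K) = 2].
    by split; lra.
  by rewrite v1 v2 v3 l3E; field.
- have fa := lam5_affine L; rewrite affine_prism_coord //.
  have [_ h1 h2 m1 _] := affine_axis K 0 fa.
  have [v1 v2 v3] := van3 _ _ _ _ (@lam5_plane _ _ L); have n := lam5_norm L.
  have [-> -> ->] : [/\ lam5 L (V1 K) = -2, lam5 L (V2 K) = -2 & lam5 L (V3 K) = -2].
    by split; lra.
  by rewrite v1 v2 v3 l3E; field.
Qed.

Definition phi_coord (l1 l2 l3 s : R) : R :=
  5 / 12 * s * (s + 1) * (s - 1) + s * (l1 * l2 + l2 * l3 + l3 * l1).

Lemma phi_prism_coord (l1 l2 l3 s : R) : l1 + l2 + l3 = 1 ->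
  phi L (prism_coord l1 l2 l3 s) = phi_coord l1 l2 l3 s.
Proof.
move=> /(@lambda_prism_coord _ _ _ s)[e0 e1 e2 e3 [e4 e5]].
by rewrite /phi e0 e1 e2 e3 e4 e5.
Qed.

(* [f] stands for the value of [phi].  [T] vanishes at all nodes but M4 and M5,
   where it is 4/3, while [phi] is -1/3 at M4, 1/3 at M5 and 0 elsewhere; the
   other functions follow by correcting the vertex functions [(li +/- s li)/2]
   and the bubbles [4 li lj].  The factors [li * 1] keep every term visibly a
   product of two affine functions. *)
Definition nodal_basis (l1 l2 l3 s f : R) : seq R :=
  let T := (s + 1) * (s - 1) + 4 * (l1 * l2 + l2 * l3 + l3 * l1) in
  let a1 := l1 * 1 + T / 12 - 2 * (l1 * l2 + l3 * l1) in
  let a2 := l2 * 1 + T / 12 - 2 * (l1 * l2 + l2 * l3) in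
  let a3 := l3 * 1 + T / 12 - 2 * (l2 * l3 + l3 * l1) in
  let b1 := s * l1 - f in
  let b2 := s * l2 - f in
  let b3 := s * l3 - f in
  [:: (a1 - b1) / 2; (a2 - b2) / 2; (a3 - b3) / 2;
      (a1 + b1) / 2; (a2 + b2) / 2; (a3 + b3) / 2;
      4 * (l2 * l3) - T / 3; 4 * (l3 * l1) - T / 3; 4 * (l1 * l2) - T / 3;
      3 / 8 * T - 3 / 2 * f; 3 / 8 * T + 3 / 2 * f].

(** * Interpolation at the nodes and the functions it reproduces *)

Definition shape (i : 'I_11) (x : 'rV[R]_3) : R :=
  (nodal_basis (lam1 L x) (lam2 L x) (lam3 L x) (lam0 L x) (phi L x))`_i.

(** The functions live on the whole space, so that affine functions and polynomials enter without
    the subtype [prism_pt]. *)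
Definition reproduced (F : 'rV[R]_3 -> R) : Prop :=
  forall x, in_prism K x -> F x = \sum_(i < 11) F (nodes K)`_i * shape i x.

Lemma reproduced_add F G :
  reproduced F -> reproduced G -> reproduced (fun x => F x + G x).
Proof.
move=> hF hG x kx; rewrite hF // hG // -big_split; apply: eq_bigr => i _.
by rewrite mulrDl.
Qed.

Lemma reproduced_scale a F : reproduced F -> reproduced (fun x => a * F x).
Proof.
move=> hF x kx; rewrite hF // mulr_sumr; apply: eq_bigr => i _.
by rewrite mulrA.
Qed.

(** Membership in [r] is kept as a premise because degree bounds are known only for monomials in the
    support. *)
Lemma reproduced_sum (I : eqType) (r : seq I) F :
  (forall i, i \in r -> reproduced (F i)) -> reproduced (fun x => \sum_(i <- r) F i x).
Proof.
elim: r => [|i r IH] h x kx.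
  by rewrite big_nil big1 // => j _; rewrite big_nil mul0r.
have hr := reproduced_add (h i (mem_head _ _))
  (IH (fun j jr => h j (mem_behead (s := i :: r) jr))).
by rewrite big_cons (hr x kx); apply: eq_bigr => j _; rewrite big_cons.
Qed.

Lemma shape_prism_coord i l1 l2 l3 s : l1 + l2 + l3 = 1 ->
  shape i (prism_coord l1 l2 l3 s) = (nodal_basis l1 l2 l3 s (phi_coord l1 l2 l3 s))`_i.
Proof.
move=> h; rewrite /shape phi_prism_coord //.
by have [-> -> -> -> _] := lambda_prism_coord s h.
Qed.

(** Writing out the sum over the nodes turns reproduction into one rational identity in the
    coordinates, within reach of [field]. *)
Lemma reproduced_coord F G :
  (forall l1 l2 l3 s, l1 + l2 + l3 = 1 -> F (prism_coord l1 l2 l3 s) = G l1 l2 l3 s) ->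
  (forall l1 l2 l3 s, l1 + l2 + l3 = 1 ->
    let w := nodal_basis l1 l2 l3 s (phi_coord l1 l2 l3 s) in
    G l1 l2 l3 s =
      G 1 0 0 (-1) * w`_0 + G 0 1 0 (-1) * w`_1 + G 0 0 1 (-1) * w`_2
      + G 1 0 0 1 * w`_3 + G 0 1 0 1 * w`_4 + G 0 0 1 1 * w`_5
      + G 0 2^-1 2^-1 0 * w`_6 + G 2^-1 0 2^-1 0 * w`_7 + G 2^-1 2^-1 0 0 * w`_8
      + G 3^-1 3^-1 3^-1 (-1) * w`_9 + G 3^-1 3^-1 3^-1 1 * w`_10) ->
  reproduced F.
Proof.
move=> FG h x /prism_coord_exists[l1 [l2 [l3 [s [l1E ->]]]]].
rewrite FG // h //.
under eq_bigr do rewrite nodes_prism_coord shape_prism_coord //.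
rewrite !big_ord_recl big_ord0 addr0 /= !addrA.
by rewrite !FG //; field.
Qed.

Lemma reproduced_mul f g : affine_fun f -> affine_fun g -> reproduced (fun x => f x * g x).
Proof.
move=> /affine_split[a1 [a2 [a3 [b fE]]]] /affine_split[c1 [c2 [c3 [d gE]]]].
apply: (@reproduced_coord _ (fun l1 l2 l3 s => (l1 * a1 + l2 * a2 + l3 * a3 + s * b)
  * (l1 * c1 + l2 * c2 + l3 * c3 + s * d))).
  by move=> l1 l2 l3 s h; rewrite fE // gE.
move=> l1 l2 l3 s h w; rewrite /w /nodal_basis /= /phi_coord.
(* Eliminating [l3] removes the constraint, and the cubic terms [f] cancel in the interpolant. *)
have -> : l3 = 1 - l1 - l2 by rewrite -h; ring.
by field.
Qed.

(** Only M4 and M5 contribute, with values -1/3 and 1/3, and the last two basis functions differ by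
    [3 * f]. *)
Lemma reproduced_phi : reproduced (phi L).
Proof.
apply: (reproduced_coord phi_prism_coord) => l1 l2 l3 s h w.
rewrite /w /nodal_basis /= /phi_coord.
have -> : l3 = 1 - l1 - l2 by rewrite -h; ring.
by field.
Qed.

(** Gives uniqueness: reproduction is linear, and it holds for [phi] and for every monomial of
    degree at most two, each being a product of affine functions. *)
Lemma P_K_sigma_eq (v : prism_pt K -> R) x : P_K L v ->
  v x = \sum_(i < 11) sigma i v * shape i (sval x).
Proof.
case=> q [c [[p [sp qE]] vE]].
have hp : reproduced (fun y => p.@[fun j => y 0 j]).
  have -> : (fun y : 'rV[R]_3 => p.@[fun j => y 0 j]) =
      (fun y => \sum_(m <- msupp p) p@_m * 'X_[R, m].@[fun j => y 0 j]).
    apply: funext => y; rewrite mevalE; apply: eq_bigr => m _.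
    by rewrite mevalX.
  apply: reproduced_sum => m /msize_mdeg_lt mp; apply: reproduced_scale.
  have [f [g [fa ga fg]]] := monomial_affine_mul R (leq_trans mp sp : (mdeg m <= 2)%N).
  by rewrite (funext fg); exact: reproduced_mul.
have hv := reproduced_add hp (reproduced_scale c reproduced_phi).
rewrite vE qE (hv _ (svalP x)); apply: eq_bigr => i _.
by rewrite /sigma vE qE.
Qed.

(** * Membership of the nodal basis in [P_K] *)

Lemma P_K_add (v w : prism_pt K -> R) : P_K L v -> P_K L w -> P_K L (fun x => v x + w x).
Proof.
case=> q [c [hq vE]] [r [d [hr wE]]]; exists (fun x => q x + r x), (c + d).
by split=> [|x]; [exact: poly_space_add | rewrite vE wE; ring].
Qed.

Lemma P_K_scale a (v : prism_pt K -> R) : P_K L v -> P_K L (fun x => a * v x).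
Proof.
case=> q [c [hq vE]]; exists (fun x => a * q x), (a * c).
by split=> [|x]; [exact: poly_space_scale | rewrite vE; ring].
Qed.

Lemma P_K_mul f g : affine_fun f -> affine_fun g ->
  P_K L (fun x => f (sval x) * g (sval x)).
Proof.
move=> fa ga; exists (fun x => f (sval x) * g (sval x)), 0.
by split=> [|x]; [exact: poly_space_mul | rewrite mul0r addr0].
Qed.

Lemma P_K_0 : P_K L (fun=> 0).
Proof.
have -> : (fun=> 0) = (fun _ : prism_pt K => 0 * 0 : R) by apply: funext => x; rewrite mul0r.
by apply: (@P_K_mul (fun=> 0) (fun=> 0)); exact: affine_cst.
Qed.

Lemma P_K_sum (I : Type) (r : seq I) (v : I -> prism_pt K -> R) :
  (forall i, P_K L (v i)) -> P_K L (fun x => \sum_(i <- r) v i x).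
Proof.
move=> hv; elim: r => [|i r IH].
  by under eq_fun do rewrite big_nil; exact: P_K_0.
by under eq_fun do rewrite big_cons; exact: P_K_add.
Qed.

Lemma P_K_phi : P_K L (fun x => phi L (sval x)).
Proof.
exists (fun=> 0), 1; split=> [|x]; last by rewrite mul1r add0r.
by exists 0; split=> [|x]; rewrite ?mmeasure0 ?meval0.
Qed.

Lemma P_K_sub (v w : prism_pt K -> R) : P_K L v -> P_K L w -> P_K L (fun x => v x - w x).
Proof.
move=> hv hw; have := P_K_add hv (P_K_scale (-1) hw).
by congr P_K; apply: funext => x; rewrite mulN1r.
Qed.

Lemma P_K_scaler a (v : prism_pt K -> R) : P_K L v -> P_K L (fun x => v x * a).
Proof.
move=> /(P_K_scale a); by congr P_K; apply: funext => x; rewrite mulrC.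
Qed.

Lemma P_K_shape i : P_K L (fun x => shape i (sval x)).
Proof.
have one := @affine_cst R 3 1.
move: (lam0_affine L) (lam1_affine L) (lam2_affine L) (lam3_affine L) => h0 h1 h2 h3.
(* These two factors produce the term [(s + 1) * (s - 1)] of [T]. *)
have h0p : affine_fun (fun x => lam0 L x + 1).
  by case: h0 => g [b h]; exists g, (b + 1) => x; rewrite h addrA.
have h0m : affine_fun (fun x => lam0 L x - 1).
  by case: h0 => g [b h]; exists g, (b - 1) => x; rewrite h addrA.
move: (P_K_mul h0p h0m) (P_K_mul h1 h2) (P_K_mul h2 h3) (P_K_mul h3 h1) => p0 p12 p23 p31.
move: (P_K_mul h1 one) (P_K_mul h2 one) (P_K_mul h3 one) => q1 q2 q3.
move: (P_K_mul h0 h1) (P_K_mul h0 h2) (P_K_mul h0 h3) P_K_phi => r1 r2 r3 f.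
(* Each basis function is a linear combination of the products collected above and [phi]. Trying
   [assumption] first keeps [li * 1] from being split as a scaling. *)
case: i => [[|[|[|[|[|[|[|[|[|[|[|//]]]]]]]]]]] hi]; rewrite /shape /nodal_basis /=;
  do ?[assumption | apply: P_K_scaler | apply: P_K_sub | apply: P_K_add | apply: P_K_scale].
Qed.

Lemma shape_node (i j : 'I_11) : shape j (nodes K)`_i = (i == j)%:R.
Proof.
case: i => [[|[|[|[|[|[|[|[|[|[|[|//]]]]]]]]]]] hi]; rewrite nodes_prism_coord /=;
  (* The side goal says that the barycentric coordinates of the node sum to 1. *)
  (rewrite shape_prism_coord; last by field);
  case: j => [[|[|[|[|[|[|[|[|[|[|[|//]]]]]]]]]]] hj];
  rewrite /nodal_basis /phi_coord /=; by field.
Qed.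

End Prism.

Theorem theorem2p2 (R : realType) (K : prism R) (L : prism_lambdas K)
    (alpha : 'I_11 -> R) :
  exists! v : prism_pt K -> R, P_K L v /\ forall i : 'I_11, sigma i v = alpha i.
Proof.
exists (fun x => \sum_i alpha i * shape L i (sval x)); split; last first.
  (* Any solution equals its own interpolant, whose coefficients are the prescribed values. *)
  move=> v [hv va]; apply: funext => x; rewrite (P_K_sigma_eq x hv).
  by apply: eq_bigr => i _; rewrite va.
split=> [|i]; first by apply: P_K_sum => i; apply: P_K_scale; exact: P_K_shape.
rewrite /sigma /= (bigD1 i) //= shape_node eqxx mulr1 big1 ?addr0 // => j ji.
by rewrite shape_node eq_sym (negbTE ji) mulr0.
Qed.
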